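(* Let $d\ge2$, let $F_d$ be the free group with free basis $\{a_1,\dots,a_d\}$, and for relatively prime integers $1\le p<q$ put $$\alpha_d(p,q):=e(F_d,\{a_1^p,a_1^q,a_2,\ldots,a_d\}),\qquad \beta_d:=e(F_d,\{a_1,a_1a_2,a_2,\ldots,a_d\}).$$ Then: (1) $\alpha_d(1,2)$ is the positive root of the equation $x^2-(2d-2)x-6d+5=0$, i.e. $\alpha_d(1,2)=d-1+\sqrt{d^2+4d-4}$. (2) $\alpha_d(1,3)$ is the positive root of the equation $x^2-(2d-1)x-4d+4=0$, i.e. $\alpha_d(1,3)=\dfrac{2d-1+\sqrt{4d^2+12d-15}}{2}$. (3) For every pair of relatively prime integers $1\le p<q$ with $(p,q)\ne(1,2)$, we have $\alpha_d(1,2)<\alpha_d(1,3)\le\alpha_d(p,q)$. (4) $\beta_d=\alpha_d(1,3)$.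
   Context: For a group $G$ with a finite generating set $S$, let $B_S(n)$ be the set of elements of $G$ of word length at most $n$ with respect to $S\cup S^{-1}$; the growth rate is $e(G,S):=\lim_{n\to\infty}|B_S(n)|^{1/n}$. *)

(* Defs.v *)
From HB Require Import structures.
From mathcomp Require Import all_boot all_order all_algebra.
From mathcomp Require Import finmap.
From mathcomp Require Import all_classical all_reals all_analysis.

Set Implicit Arguments.
Unset Strict Implicit.
Unset Printing Implicit Defensive.

Import Order.TTheory GRing.Theory Num.Theory.
Import numFieldNormedType.Exports.

Local Open Scope classical_set_scope.
Local Open Scope group_scope.

(* The free group on X is modelled by reduced words: the letter (x, false)     *)
(* stands for x and (x, true) for its inverse.                                 *)
Section FreeGroup.
Variable X : choiceType.

Definition letter : Type := (X * bool)%type.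

Definition inv_letter (l : letter) : letter := (l.1, ~~ l.2).

Definition reduced (w : seq letter) : bool :=
  sorted (fun k l => l != inv_letter k) w.

Record free_group : Type :=
  FreeWord { word :> seq letter; word_reduced : reduced word }.

HB.instance Definition _ := [isSub for word].
HB.instance Definition _ := [Choice of free_group by <:].

Definition push (l : letter) (w : seq letter) : seq letter :=
  if w is k :: w' then if k == inv_letter l then w' else l :: w else [:: l].

Lemma inv_letterK : involutive inv_letter.
Proof. by case=> x b; rewrite /inv_letter /= negbK. Qed.

Lemma push_reduced l w : reduced w -> reduced (push l w).
Proof.
case: w => [|k w] //= rw.
by case: ifPn => [_|kl /=]; [exact: path_sorted rw|rewrite kl].
Qed.

Lemma foldr_push_reduced u v : reduced v -> reduced (foldr push v u).
Proof. by move=> rv; elim: u => //= l u; exact: push_reduced. Qed.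

Lemma foldr_push_nil w : reduced w -> foldr push [::] w = w.
Proof.
elim: w => //= l w IHw rw; rewrite IHw; last exact: path_sorted rw.
by case: w rw {IHw} => //= k w /andP[/negPf-> _].
Qed.

Lemma pushK l w : reduced w -> push (inv_letter l) (push l w) = w.
Proof.
case: w => [|k w] /=; first by rewrite inv_letterK eqxx.
case: ifPn => [/eqP->|_] /=; last by rewrite inv_letterK eqxx.
case: w => [|m w] //= /andP[ml _].
by rewrite (negPf ml).
Qed.

Lemma foldr_push_push l u v : reduced u -> reduced v ->
  foldr push v (push l u) = push l (foldr push v u).
Proof.
case: u => [|k u] //= ru rv; case: ifPn => [/eqP->|//].
by rewrite -{1}(inv_letterK l) pushK// foldr_push_reduced.
Qed.

Lemma foldr_push_inv u v : reduced v ->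
  foldr push (foldr push v u) (rev (map inv_letter u)) = v.
Proof.
move=> rv; elim: u => //= l u IHu.
by rewrite rev_cons foldr_rcons pushK ?IHu// foldr_push_reduced.
Qed.

Lemma inv_reduced w : reduced w -> reduced (rev (map inv_letter w)).
Proof.
rewrite /reduced rev_sorted sorted_map => /sub_sorted; apply => k l /=.
by apply: contra => /eqP->; rewrite inv_letterK.
Qed.

Definition free_one : free_group := FreeWord (isT : reduced [::]).

Definition free_mul (u v : free_group) : free_group :=
  FreeWord (foldr_push_reduced u (word_reduced v)).

Definition free_inv (u : free_group) : free_group :=
  FreeWord (inv_reduced (word_reduced u)).

Lemma free_mulA : associative free_mul.
Proof.
move=> u v w; apply/val_inj => /=; elim: (word u) => //= l s ->.
by rewrite foldr_push_push ?word_reduced// foldr_push_reduced// word_reduced.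
Qed.

Lemma free_mul1g : left_id free_one free_mul.
Proof. by move=> u; apply/val_inj. Qed.

Lemma free_mulg1 : right_id free_one free_mul.
Proof. by move=> u; apply/val_inj/foldr_push_nil/word_reduced. Qed.

Lemma free_mulVg : left_inverse free_one free_inv free_mul.
Proof.
move=> u; apply/val_inj => /=.
by rewrite -{1}(foldr_push_nil (word_reduced u)) foldr_push_inv.
Qed.

Lemma free_invK : involutive free_inv.
Proof.
move=> u; apply/val_inj => /=.
by rewrite map_rev revK mapK//; exact: inv_letterK.
Qed.

Lemma free_mulgV : right_inverse free_one free_inv free_mul.
Proof. by move=> u; rewrite -{1}(free_invK u) free_mulVg. Qed.

HB.instance Definition _ := isGroup.Build free_group
  free_mulA free_mul1g free_mulg1 free_mulVg free_mulgV.

Definition free_gen (x : X) : free_group :=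
  FreeWord (isT : reduced [:: (x, false)]).

Lemma free_group_universal (H : groupType) (f : X -> H) :
  exists! phi : free_group -> H,
    {morph phi : u v / u * v} /\ forall x, phi (free_gen x) = f x.
Proof.
pose ev (l : letter) := if l.2 then (f l.1)^-1 else f l.1.
pose evw (w : seq letter) := \prod_(l <- w) ev l.
have evV l : ev (inv_letter l) = (ev l)^-1.
  by case: l => x [] //=; rewrite /ev /= invgK.
have evp l w : evw (push l w) = ev l * evw w.
  rewrite /evw; case: w => [|k w] /=; first by rewrite big_cons.
  case: ifP => [/eqP->|_]; rewrite !big_cons//.
  by rewrite evV mulgA mulgV mul1g.
exists (fun u => evw (word u)); split; [split|].
- move=> u v /=; rewrite /mul /=; elim: (word u) => /= [|l w IH].
    by rewrite /evw big_nil mul1g.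
  by rewrite evp IH /evw big_cons mulgA.
- by move=> x; rewrite /evw /= big_seq1.
move=> phi [phiM phig]; apply/funext => -[w rw] /=.
have phi1 : phi 1 = 1 by apply: (mulgI (phi 1)); rewrite -phiM !mulg1.
have phiV x : phi (free_gen x)^-1 = (f x)^-1.
  by apply: (mulgI (f x)); rewrite mulgV -phig -phiM mulgV phi1.
elim: w rw => [|[x b] w IH] rw.
  rewrite /evw big_nil -phi1; congr phi; exact/val_inj.
have rw' : reduced w by exact: path_sorted rw.
have -> : FreeWord rw =
    (if b then (free_gen x)^-1 else free_gen x) * FreeWord rw'.
  apply/val_inj; rewrite -[LHS](foldr_push_nil rw) /=.
  by rewrite (foldr_push_nil rw'); case: b {rw}.
rewrite phiM -IH /evw big_cons; congr (_ * _).
by case: b {rw}; rewrite /ev /= ?phiV ?phig.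
Qed.

End FreeGroup.

Definition word_ball (G : groupType) (S : set G) (n : nat) : set G :=
  [set g | exists w : seq G, [/\ (size w <= n)%N,
     (forall x, x \in w -> (S `|` [set y^-1 | y in S]) x) &
     g = \prod_(x <- w) x]].

(* fset_set A is empty when A is infinite, so growth_rate below only makes     *)
(* sense because of this finiteness.                                           *)
Lemma finite_word_ball (G : groupType) (S : set G) (n : nat) :
  finite_set S -> finite_set (word_ball S n).
Proof.
move=> finS; set T := S `|` [set y^-1 | y in S].
have finT : finite_set T by rewrite finite_setU; split=> //; exact: finite_image.
elim: n => [|n IHn].
  apply: (@sub_finite_set _ _ [set 1]) => // g [[|x w]] [] //= _ _ ->.
  by rewrite big_nil.
apply: (@sub_finite_set _ _
  ([set 1] `|` [set x * y | x in T & y in word_ball S n])).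
  move=> g [[|x w]] [] /= sw Tw ->; first by left; rewrite big_nil.
  right; exists x; first by apply: Tw; rewrite mem_head.
  exists (\prod_(y <- w) y); last by rewrite big_cons.
  by exists w; split=> // y yw; apply: Tw; rewrite inE yw orbT.
by rewrite finite_setU; split=> //; exact: finite_image2.
Qed.

Definition growth_rate (R : realType) (G : groupType) (S : set G) : R :=
  lim ((fun n : nat =>
    (#|` fset_set (word_ball S n)|%:R : R) `^ n%:R^-1)%R @ \oo).

(* 'I_d counts from 0: the basis element a_k is free_gen of the ordinal k - 1. *)
Section Generators.
Variables (d : nat) (d_ge2 : (2 <= d)%N).

Definition basis1 : free_group 'I_d := free_gen (Ordinal (ltnW d_ge2)).
Definition basis2 : free_group 'I_d := free_gen (Ordinal d_ge2).
Definition basis_tail : set (free_group 'I_d) :=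
  [set free_gen i | i in [set i : 'I_d | (1 <= i)%N]].

Definition alpha_gens (p q : nat) : set (free_group 'I_d) :=
  [set basis1 ^+ p; basis1 ^+ q] `|` basis_tail.

Definition beta_gens : set (free_group 'I_d) :=
  [set basis1; basis1 * basis2] `|` basis_tail.

End Generators.

Definition alpha (R : realType) (d : nat) (d_ge2 : (2 <= d)%N) (p q : nat) : R :=
  growth_rate R (alpha_gens d_ge2 p q).

Definition beta (R : realType) (d : nat) (d_ge2 : (2 <= d)%N) : R :=
  growth_rate R (beta_gens d_ge2).

(* Main.v *)
(** Each growth rate is the Perron eigenvalue [l] of a finite automaton whose
    accepted words are spelled by the given generators.  If accepted words have
    distinct values, then [l] is a lower bound for the growth rate; if the product
    of a generator and an accepted word of length [n] is the value of an accepted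
    word of length at most [n + 1], then [l] is an upper bound.  A positive
    eigenvector of the transition matrix counts the accepted words up to
    constants, and Fekete's lemma provides the limit.

    For [a^p, a^q] the accepted runs of [a] are [a^(kq)] and [a^(kq+p)],
    [k >= 0] (with their inverses), and also [a^(kq-p)] when [b = true].  These
    exponents are distinct as soon as [p < q] and, if [b = true], [q <> 2p], so
    [b = true] gives the lower bound [alpha(1,3)] for every pair except (1,2).
    Every power is covered when [(p, q, b)] is (1,2,false) or (1,3,true).

    For [beta] write [m = ab].  The accepted words never contain two adjacent
    letters among [a, b, m] and their inverses whose product is again such a
    letter, so their expansions in [a, b] are reduced. *)

Require Import Defs.
From mathcomp Require Import all_boot all_order all_algebra.
From mathcomp Require Import finmap.
From mathcomp Require Import all_classical all_reals all_analysis.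
From mathcomp Require Import zify ring lra.

Set Implicit Arguments.
Unset Strict Implicit.
Unset Printing Implicit Defensive.

Import Order.TTheory GRing.Theory Num.Theory.
Import numFieldNormedType.Exports.

Local Open Scope ring_scope.

(** * Growth rates as limits, and comparison with exponential bounds *)

Section Growth.
Local Open Scope classical_set_scope.
Variable R : realType.
Implicit Types u : nat -> R.

Lemma cvg_scale_inv (c : R) : n%:R^-1 * c @[n --> \oo] --> (0 : R).
Proof.
rewrite -(mul0r c); apply: cvgMl; rewrite -(cvg_shiftS _); exact: cvg_harmonic.
Qed.

(** The limit is the infimum of the quotients over positive [n], which is finite because [u] is
    nonnegative. *)
Lemma fekete u : (forall n, 0 <= u n) ->
  (forall m n, u (m + n)%N <= u m + u n) -> cvg (n%:R^-1 * u n @[n --> \oo]).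
Proof.
move=> u0 uD.
have uM m q : u (q * m)%N <= q%:R * u m + u 0%N.
  elim: q => [|q IH]; first by rewrite mul0r add0r.
  by rewrite mulSn (le_trans (uD _ _))// -natr1 mulrDl mul1r; lra.
pose A := [set n.+1%:R^-1 * u n.+1 | n in [set: nat]].
have A0 : lbound A 0.
  by move=> _ [n _ <-]; rewrite mulr_ge0 ?invr_ge0.
have hA : has_inf A by split; [exists (1%:R^-1 * u 1%N), 0%N|exists 0].
have infA n : (0 < n)%N -> inf A <= n%:R^-1 * u n.
  by case: n => // n _; apply: (ge_inf hA.2); exists n.
suff : n%:R^-1 * u n @[n --> \oo] --> inf A by move/cvgP.
apply/cvgrPdist_le => /= e e0.
have [_ [m _ <-] mlt] : exists2 x, A x & x < inf A + e / 2.
  by apply: inf_adherent => //; rewrite divr_gt0.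
(* [M] absorbs the remainder of [n] modulo [m.+1]; the term [u 0] comes from [uM], since [u 0] need
   not vanish. *)
pose M := \sum_(r < m.+1) u r + u 0%N.
have uM' n : n%:R^-1 * u n <= m.+1%:R^-1 * u m.+1 + n%:R^-1 * M.
  have [->|n0] := posnP n.
    by rewrite invr0 !mul0r addr0 mulr_ge0 ?invr_ge0.
  have un : u n <= (n %/ m.+1)%:R * u m.+1 + M.
    rewrite {1}(divn_eq n m.+1) (le_trans (uD _ _))//.
    have := uM m.+1 (n %/ m.+1)%N; rewrite /M.
    have : u (n %% m.+1)%N <= \sum_(r < m.+1) u r.
      rewrite (bigD1 (Ordinal (ltn_pmod n (ltn0Sn m))))//= lerDl.
      by apply: sumr_ge0 => i _.
    by lra.
  rewrite mulrC ler_pdivrMr ?ltr0n// (le_trans un)//.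
  rewrite mulrDl [n%:R^-1 * M * _]mulrAC mulVf ?mul1r ?pnatr_eq0 -?lt0n//.
  rewrite lerD2r mulrAC ler_wpM2r// mulrC ler_pdivlMr ?ltr0n// -natrM ler_nat.
  exact: leq_trunc_div.
have /cvgrPdist_le/(_ (e / 2)) := cvg_scale_inv M.
move=> /(_ ltac:(by rewrite divr_gt0)) ev.
near=> n.
have n0 : (0 < n)%N by near: n; exists 1%N.
have := infA _ n0; have := uM' n.
have : `|0 - n%:R^-1 * M| <= e / 2 by near: n.
rewrite sub0r normrN ler_norml ler_distl => /andP[_ h1] h2 h3.
clear -h1 h2 h3 mlt e0.
move: (_ * u n) (_ * u m.+1) (_ * M) (inf A) h1 h2 h3 mlt => x y z i.
by move=> *; apply/andP; split; lra.
Unshelve. all: end_near. Qed.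

Definition ball_size (G : groupType) (S : set G) n : nat :=
  #|` fset_set (word_ball S n)|.

Section Ball.
Variables (G : groupType) (S : set G).
Hypothesis finS : finite_set S.
Local Notation b := (ball_size S).

Lemma ball_size_gt0 n : (0 < b n)%N.
Proof.
rewrite /ball_size cardfs_gt0; apply/fset0Pn; exists 1%g.
rewrite in_fset_set; last exact: finite_word_ball.
by rewrite inE; exists [::]; split => //; rewrite big_nil.
Qed.

Lemma ball_size_ge n (s : seq G) : uniq s ->
  (forall x, x \in s -> word_ball S n x) -> (size s <= b n)%N.
Proof.
move=> us sS; rewrite /ball_size.
have -> : size s = #|` [fset x in s]%fset|.
  by rewrite card_fseq undup_id.
apply/fsubset_leq_card/fsubsetP => x; rewrite !inE => xs.
by rewrite in_fset_set ?inE; [exact: sS|exact: finite_word_ball].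
Qed.

Lemma ball_size_le n (s : seq G) :
  (forall x, word_ball S n x -> x \in s) -> (b n <= size s)%N.
Proof.
move=> sS; rewrite /ball_size (@leq_trans #|` [fset x in s]%fset|)//.
  apply/fsubset_leq_card/fsubsetP => x.
  rewrite in_fset_set; last exact: finite_word_ball.
  by rewrite !inE; exact: sS.
by rewrite card_fseq size_undup.
Qed.

(** Cutting a word after [m] letters writes its value as a product of elements of the two smaller
    balls. *)
Lemma ball_size_leM m n : (b (m + n) <= b m * b n)%N.
Proof.
rewrite -(size_allpairs *%g); apply: ball_size_le => _ [w [sw Sw ->]].
rewrite -(cat_take_drop m w) big_cat; apply: allpairs_f.
  rewrite in_fset_set ?inE; last exact: finite_word_ball.
  exists (take m w); split=> [|x /mem_take|//]; last exact: Sw.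
  by rewrite size_take; case: ltnP.
rewrite in_fset_set ?inE; last exact: finite_word_ball.
exists (drop m w); split=> [|x /mem_drop|//]; last exact: Sw.
by rewrite size_drop leq_subLR.
Qed.

(** Submultiplicativity makes [ln (b n)] subadditive, so [fekete] applies and the [lim] in
    [growth_rate] is a genuine limit. *)
Lemma growth_rate_expR :
  growth_rate R S = expR (lim (n%:R^-1 * ln (b n)%:R @[n --> \oo])) /\
  cvg (n%:R^-1 * ln ((b n)%:R : R) @[n --> \oo]).
Proof.
have b1 n : 1 <= (b n)%:R :> R by rewrite ler1n ball_size_gt0.
have cv : cvg (n%:R^-1 * ln ((b n)%:R : R) @[n --> \oo]).
  apply: fekete => [n|m n]; first exact: ln_ge0.
  rewrite -lnM ?posrE ?(lt_le_trans ltr01)// -natrM.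
  by rewrite ler_ln ?posrE ?ltr0n ?muln_gt0 ?ball_size_gt0 // ler_nat ball_size_leM.
split=> //; apply: cvg_lim => //.
(* [powR] treats base 0 separately; that clause is excluded because balls are nonempty. *)
rewrite (_ : (fun n => _) = (fun n => expR (n%:R^-1 * ln (b n)%:R))); last first.
  apply/funext => n; rewrite /powR -/(ball_size S n) ifF//.
  by apply/negbTE; rewrite pnatr_eq0 -lt0n ball_size_gt0.
exact: (continuous_cvg _ (@continuous_expR R _) cv).
Qed.

Lemma ln_scale (c l : R) n : 0 < c -> 0 < l -> (0 < n)%N ->
  n%:R^-1 * ln (c * l ^+ n) = n%:R^-1 * ln c + ln l.
Proof.
move=> c0 l0 n0; rewrite lnM ?posrE ?exprn_gt0// lnXn// -[ln l *+ n]mulr_natl.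
by rewrite mulrDr mulKf// pnatr_eq0 -lt0n.
Qed.

Lemma cvg_ln_scale (c l : R) :
  n%:R^-1 * ln c + ln l @[n --> \oo] --> ln l.
Proof.
rewrite -[X in _ --> X]add0r.
by apply: cvgD; [exact: cvg_scale_inv|exact: cvg_cst].
Qed.

(** After taking logarithms and dividing by [n], the contribution of [c] tends to 0. *)
Lemma growth_rate_ge (c l : R) : 0 < c -> 0 < l ->
  (forall n, c * l ^+ n <= (b n)%:R) -> l <= growth_rate R S.
Proof.
move=> c0 l0 h; have [-> cv] := growth_rate_expR.
have cl := @cvg_ln_scale c l.
rewrite -[leLHS]lnK// ler_expR -(cvg_lim _ cl)//.
apply: ler_lim => //; first exact: cvgP cl.
exists 1%N => // n /= n0; rewrite -ln_scale// ler_wpM2l ?invr_ge0//.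
by rewrite ler_ln ?posrE ?mulr_gt0 ?exprn_gt0 ?ltr0n ?ball_size_gt0.
Qed.

Lemma growth_rate_le (c l : R) : 0 < c -> 0 < l ->
  (forall n, (b n)%:R <= c * l ^+ n) -> growth_rate R S <= l.
Proof.
move=> c0 l0 h; have [-> cv] := growth_rate_expR.
have cl := @cvg_ln_scale c l.
rewrite -[leRHS]lnK// ler_expR -(cvg_lim _ cl)//.
apply: ler_lim => //; first exact: cvgP cl.
exists 1%N => // n /= n0; rewrite -ln_scale// ler_wpM2l ?invr_ge0//.
by rewrite ler_ln ?posrE ?mulr_gt0 ?exprn_gt0 ?ltr0n ?ball_size_gt0.
Qed.

End Ball.

(** * Counting the words accepted by an automaton *)

Section Automaton.
Variables (K : finType) (r : rel K).

(** The states are the letters themselves: [r x y] lets [y] follow [x]. The starting letter [x] is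
    not part of the listed words. *)
Fixpoint paths (x : K) (n : nat) : seq (seq K) :=
  if n is n'.+1 then [seq y :: w | y <- enum (r x), w <- paths y n']
  else [:: [::]].

Lemma mem_paths x n w : (w \in paths x n) = (size w == n) && path r x w.
Proof.
elim: n x w => [|n IH] x w /=; first by case: w.
apply/allpairsPdep/idP => [[y [w' []]]|].
  rewrite mem_enum IH => xy /andP[/eqP<- pw] -> /=.
  by rewrite eqxx pw andbT; exact: xy.
case: w => [//|y w] /=; rewrite eqSS => /and3P[sw xy pw].
by exists y, w; rewrite IH sw; split=> //; rewrite mem_enum.
Qed.

Lemma paths_uniq x n : uniq (paths x n).
Proof.
elim: n x => [//|n IH] x /=; apply: allpairs_uniq_dep => //.
- exact: enum_uniq.
- by move=> [y w] [y' w'] _ _ /= [-> ->].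
Qed.

Lemma size_paths x n :
  size (paths x n.+1) = (\sum_(y | r x y) size (paths y n))%N.
Proof. by rewrite /= size_allpairs_dep sumnE big_map big_enum. Qed.

Variables (v : K -> R) (l : R).
Hypothesis v_gt0 : forall x, 0 < v x.
Hypothesis l_gt1 : 1 < l.
Hypothesis eigen : forall x, \sum_(y | r x y) v y = l * v x.

Lemma eigen_paths x n :
  l ^+ n.+1 * v x = \sum_(y | r x y) l ^+ n * v y.
Proof. by rewrite -mulr_sumr eigen exprSr mulrA. Qed.

(** By the eigenvector equation, [l ^+ n * v x] is the total weight of the states reached along
    [paths x n], each at most [M]. *)
Lemma paths_lower (M : R) x n : (forall y, v y <= M) ->
  l ^+ n * v x <= M * (size (paths x n))%:R.
Proof.
move=> vM; elim: n x => [|n IH] x; first by rewrite mul1r mulr1 vM.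
by rewrite eigen_paths size_paths natr_sum mulr_sumr ler_sum.
Qed.

Lemma paths_upper (m : R) x n : (forall y, m <= v y) ->
  m * (size (paths x n))%:R <= l ^+ n * v x.
Proof.
move=> vM; elim: n x => [|n IH] x; first by rewrite mul1r mulr1 vM.
by rewrite eigen_paths size_paths natr_sum mulr_sumr ler_sum.
Qed.

Variables (G : groupType) (S : set G) (g : K -> G).
Hypothesis finS : finite_set S.
Hypothesis S_range : S `|` [set y^-1%g | y in S] = range g.

Definition eval_word (w : seq K) : G := (\prod_(k <- w) g k)%g.

Lemma eval_word_cons k w : eval_word (k :: w) = (g k * eval_word w)%g.
Proof. by rewrite /eval_word big_cons. Qed.

Lemma word_ball_eval w : word_ball S (size w) (eval_word w).
Proof.
exists (map g w); rewrite size_map big_map; split=> // _ /mapP[k _ ->].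
by rewrite S_range; exists k.
Qed.

Lemma growth_rate_ge_automaton (x0 : K) :
  {in [pred w | sorted r w] &, injective eval_word} -> l <= growth_rate R S.
Proof.
move=> ev_inj; pose M := \sum_x v x.
have vM x : v x <= M.
  by rewrite /M (bigD1 x)//= lerDl sumr_ge0// => y _; exact: ltW.
have M0 : 0 < M := lt_le_trans (v_gt0 x0) (vM x0).
apply: (growth_rate_ge finS (c := v x0 / M)).
- by rewrite divr_gt0.
- exact: lt_trans l_gt1.
move=> n; rewrite mulrAC ler_pdivrMr// mulrC [leRHS]mulrC.
apply: (le_trans (paths_lower _ _ vM)); rewrite ler_pM2l// ler_nat.
rewrite -(size_map eval_word); apply: ball_size_ge => //.
  rewrite map_inj_in_uniq ?paths_uniq// => w w'.
  rewrite !mem_paths => /andP[_ pw] /andP[_ pw']; apply: ev_inj.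
    by rewrite inE (path_sorted pw).
  by rewrite inE (path_sorted pw').
move=> _ /mapP[w + ->]; rewrite mem_paths => /andP[/eqP<- _].
exact: word_ball_eval.
Qed.

(** The index [k] counts the letters after the first, hence [k < n]; the empty word is listed
    separately. *)
Definition words_upto n : seq (seq K) :=
  [::] :: flatten
    [seq [seq x :: w | x <- enum K, w <- paths x k] | k <- iota 0 n].

Lemma mem_words_upto n w :
  (size w <= n)%N -> sorted r w -> w \in words_upto n.
Proof.
case: w => [|x w] /= sw pw; first by rewrite mem_head.
rewrite inE /=; apply/flattenP => /=.
exists [seq x :: w | x <- enum K, w <- paths x (size w)].
  by apply/mapP; exists (size w) => //; rewrite mem_iota.
by apply/allpairsPdep; exists x, w; rewrite mem_enum mem_paths eqxx.
Qed.

Lemma words_upto_upper (m : R) n : 0 < m -> (forall y, m <= v y) ->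
  (size (words_upto n))%:R <= (1 + (\sum_x v x) / (m * (l - 1))) * l ^+ n.
Proof.
move=> m0 mv; set V := \sum_x v x.
have V0 : 0 <= V by apply: sumr_ge0 => x _; exact: ltW.
have l0 : 0 < l - 1 by rewrite subr_gt0.
have ln1 k : 1 <= l ^+ k by rewrite exprn_ege1// ltW.
elim: n => [|n IH].
  by rewrite /= expr0 mulr1 lerDl divr_ge0// ltW// mulr_gt0.
have -> : size (words_upto n.+1) =
    (size (words_upto n) + \sum_x size (paths x n))%N.
  rewrite /words_upto -addn1 iotaD map_cat flatten_cat /= cats0 size_cat add0n.
  by rewrite size_allpairs_dep sumnE big_map big_enum.
rewrite natrD natr_sum.
have : \sum_x (size (paths x n))%:R <= V / m * l ^+ n.
  rewrite mulrAC ler_pdivlMr// mulr_suml mulr_suml; apply: ler_sum => x _.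
  by rewrite mulrC [leRHS]mulrC paths_upper.
rewrite exprS.
(* With [C = V / (m * (l - 1))], the at most [V / m * l ^+ n] new words are exactly what raises
   [C * l ^+ n] to [C * l ^+ n.+1]. *)
have -> : V / m = (l - 1) * (V / (m * (l - 1))).
  by field; rewrite (gt_eqF m0) (gt_eqF l0).
set C := V / _; move: IH (ln1 n); rewrite -/C; nra.
Qed.

(** Multiplying the letters of a product one at a time, starting from the right, covers each ball by
    accepted words of no greater length. *)
Lemma growth_rate_le_automaton :
  (forall k w, sorted r w -> exists w',
     [/\ sorted r w', (size w' <= (size w).+1)%N
       & (g k * eval_word w)%g = eval_word w']) ->
  growth_rate R S <= l.
Proof.
move=> closed.
have ball n x : word_ball S n x -> x \in map eval_word (words_upto n).
  move=> [w [sw Sw ->]].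
  suff [w' [rw' sw' ->]] : exists w', [/\ sorted r w', (size w' <= size w)%N &
      (\prod_(x <- w) x)%g = eval_word w'].
    by apply: map_f; apply: mem_words_upto => //; exact: leq_trans sw.
  elim: w Sw {sw} => [|y w IH] Sw.
    by exists [::]; rewrite /eval_word !big_nil.
  have [|w' [rw' sw' ew']] := IH.
    by move=> z zw; apply: Sw; rewrite inE zw orbT.
  have : range g y by rewrite -S_range; apply: Sw; rewrite mem_head.
  move=> [k _ <-]; have [w2 [rw2 sw2 e]] := closed k w' rw'.
  by exists w2; split=> //; [exact: leq_trans sw2 _|rewrite big_cons ew'].
have l0 : 0 < l - 1 by rewrite subr_gt0.
(* An explicit positive lower bound for all the weights; adding 1 keeps the inverted sum
   positive. *)
pose m := (1 + \sum_x (v x)^-1)^-1.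
have vV x : 0 <= (v x)^-1 by rewrite invr_ge0 ltW.
have m0 : 0 < m by rewrite invr_gt0 ltr_wpDr// sumr_ge0.
have mv x : m <= v x.
  rewrite -[leRHS]invrK lef_pV2 ?posrE ?invr_gt0// ?ltr_wpDr ?sumr_ge0//.
  by rewrite (bigD1 x)//= addrCA lerDl addr_ge0 ?sumr_ge0.
apply: (growth_rate_le finS (c := 1 + (\sum_x v x) / (m * (l - 1)))).
- have : 0 <= \sum_x v x by apply: sumr_ge0 => x _; exact: ltW.
  by move=> V0; rewrite ltr_wpDr// divr_ge0// ltW// mulr_gt0.
- exact: lt_trans l_gt1.
move=> n; apply: le_trans (words_upto_upper n m0 mv); rewrite ler_nat.
by rewrite -(size_map eval_word); apply: ball_size_le => // x; exact: ball.
Qed.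

End Automaton.

End Growth.

Lemma big_option (T : Type) (idx : T) (op : Monoid.com_law idx) (I : finType)
    (F : option I -> T) :
  \big[op/idx]_x F x = op (F None) (\big[op/idx]_i F (Some i)).
Proof.
rewrite (bigD1 None)//=; congr (op _ _).
rewrite (reindex_omap Some id)/=; last by case.
by apply: eq_bigl => i; rewrite eqxx.
Qed.

(** * Generators together with their inverses *)

Section SignedGenerators.
Local Open Scope classical_set_scope.
Local Open Scope group_scope.
Variables (I : finType) (G : groupType) (base : I -> G).

Definition signed (x : I * bool) : G := if x.2 then (base x.1)^-1 else base x.1.

Definition flip_sign (x : I * bool) : I * bool := (x.1, ~~ x.2).

Lemma signed_flip x : signed (flip_sign x) = (signed x)^-1.
Proof. by case: x => i []; rewrite /signed /= ?invgK. Qed.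

Lemma range_signed (S : set G) : S = range base ->
  S `|` [set y^-1 | y in S] = range signed.
Proof.
move=> ->; apply/seteqP; split=> [x [[i _ <-]|[_ [i _ <-] <-]]|_ [[i []] _ <-]].
- by exists (i, false).
- by exists (i, true).
- by right; exists (base i) => //; exists i.
- by left; exists i.
Qed.

Lemma finite_range_fin (S : set G) : S = range base -> finite_set S.
Proof. by move=> ->; exact/finite_image/finite_finset. Qed.

End SignedGenerators.

(** * Sums over signed letters *)

Section LetterSums.
Variables (R : realType) (I : finType).

Lemma sum_option_bool (F : option I * bool -> R) :
  \sum_x F x = \sum_s F (None, s) + \sum_i \sum_s F (Some i, s).
Proof.
rewrite -(big_option _ (fun o => \sum_s F (o, s))) pair_bigA.
by apply: eq_bigr => -[].
Qed.

Lemma sum_pairs (P : pred I) (a : R) :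
  \sum_(j | P j) \sum_(t : bool) a = 2 * #|P|%:R * a.
Proof.
by rewrite sumr_const big_bool /= -[LHS]mulr_natl; ring.
Qed.

(** The forbidden letter has its index in [P], so exactly one of the [2 * #|P|] terms is lost. *)
Lemma sum_pairs_but (P : pred I) (a : R) (i : I) (s : bool) : P i ->
  \sum_(j | P j) \sum_t
    (if (Some j, t) != flip_sign (Some i, s) then a else 0)
  = (2 * #|P|%:R - 1) * a.
Proof.
move=> Pi; rewrite (bigD1 i)//= mulrBl mul1r -sum_pairs [in RHS](bigD1 i)//=.
rewrite [X in _ + X](_ : _ = \sum_(j | P j && (j != i)) \sum_(t : bool) a).
  rewrite !big_bool /flip_sign !xpair_eqE !eqxx /=.
  by case: s; rewrite /=; ring.
apply: eq_bigr => j /andP[_ ji]; apply: eq_bigr => t _.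
by rewrite ifT// /flip_sign xpair_eqE negb_and; apply/orP; left.
Qed.

End LetterSums.

(** * Initial exponents of reduced words *)

Section FreeWords.
Local Open Scope group_scope.
Variable X : choiceType.
Implicit Types (l : letter X) (h : free_group X).

Definition letter_gen l : free_group X :=
  if l.2 then (free_gen l.1)^-1 else free_gen l.1.

Lemma word_letter_genM l h : word (letter_gen l * h) = push l (word h).
Proof. by case: l => x []. Qed.

Variable x0 : X.

Definition sgn (s : bool) : int := if s then (- 1)%R else 1%R.

(** On a reduced word this is the exponent of the maximal power of [x0] with which the word
    begins. *)
Fixpoint expo (w : seq (letter X)) : int :=
  if w is (x, s) :: w' then
    if x == x0 then (sgn s + expo w')%R else 0%R
  else 0%R.

(** Cancelling an opposite first letter changes the initial exponent by the same amount as
    prepending does. *)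
Lemma expo_push s w : expo (push (x0, s) w) = (sgn s + expo w)%R.
Proof.
case: w => [|[x t] w] /=; first by rewrite eqxx.
rewrite /inv_letter xpair_eqE /=.
have [->|xx0] /= := eqVneq x x0; last by rewrite eqxx (negPf xx0).
by case: s; case: t; rewrite /= ?eqxx /sgn /=; lia.
Qed.

Lemma expo_letter_genX s n h :
  expo (word (letter_gen (x0, s) ^+ n * h)) = (sgn s * n%:Z + expo (word h))%R.
Proof.
elim: n => [|n IH]; first by rewrite expg0 mul1g; lia.
by rewrite expgS -mulgA word_letter_genM expo_push IH; lia.
Qed.

End FreeWords.

(** * The automaton for the generators [a^p] and [a^q] *)

Section Alpha.
Local Open Scope group_scope.
Variables (d : nat) (i0 : 'I_d) (p q : nat) (b : bool).

Local Notation K := (option 'I_d * bool)%type.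

Definition alpha_base (o : option 'I_d) : free_group 'I_d :=
  if o is Some i then if i == i0 then free_gen i0 ^+ p else free_gen i
  else free_gen i0 ^+ q.

Local Notation gen := (signed alpha_base).
Local Notation ev := (eval_word gen).

(* A run of powers of [a] is [Q^k P^e] with [P = a^p], [Q = a^q] and [e] at most
   1 in absolute value; the signs of [P] and [Q] may differ only if [b] holds. *)
Definition alpha_next : rel K := fun x y =>
  match x.1, y.1 with
  | None, None => x.2 == y.2
  | None, Some j => [|| j != i0, b | x.2 == y.2]
  | Some i, None => i != i0
  | Some i, Some j => if i == i0 then j != i0 else y != flip_sign x
  end.

Lemma gen_q s : gen (None, s) = letter_gen (i0, s) ^+ q.
Proof. by case: s => //; rewrite /letter_gen /= expVgn. Qed.

Lemma gen_p s : gen (Some i0, s) = letter_gen (i0, s) ^+ p.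
Proof. by rewrite /signed /= eqxx; case: s => //; rewrite /letter_gen /= expVgn. Qed.

Lemma gen_tail i s : i != i0 -> gen (Some i, s) = letter_gen (i, s).
Proof. by move=> /negPf ii0; rewrite /signed /= ii0. Qed.

Section Injectivity.
Hypotheses (p_gt0 : (0 < p)%N) (lt_pq : (p < q)%N) (q_neq2p : b -> q != (2 * p)%N).

Local Notation e w := (expo i0 (word (ev w))).

(** A run starting with [Q] has exponent at least [q] in the direction of [Q], except [Q P^-1], with
    exponent [q - p]. A run starting with [P] is [P] alone. Any other first letter survives
    reduction. *)
Let head_spec (w : seq K) : Prop :=
  match w with
  | [::] => True
  | (None, s) :: _ =>
      (sgn s * e w = q%:Z - p%:Z /\ b)%R \/ (q%:Z <= sgn s * e w)%R
  | (Some i, s) :: w' =>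
      if i == i0 then e w = (sgn s * p%:Z)%R
      else word (ev w) = (i, s) :: word (ev w')
  end.

Lemma alpha_head w : sorted alpha_next w -> head_spec w.
Proof.
elim: w => [//|[k s] w IH] /= pw; have {IH} := IH (path_sorted pw).
case: k pw => [i|] pw; last first.
  rewrite eval_word_cons gen_q expo_letter_genX.
  case: w pw => [|[[i|] t] w] /=.
  - by rewrite /eval_word big_nil /=; case: s; rewrite /sgn; lia.
  - rewrite /alpha_next /= => /andP[nx _].
    case: eqVneq nx => [->|ii0] /= nx; last first.
      by move=> -> /=; rewrite (negPf ii0); case: s {nx}; rewrite /sgn; lia.
    move=> ->.
    by case: s nx; case: t; case: (b); rewrite /sgn //=; lia.
  - rewrite /alpha_next /= => /andP[/eqP<- _].
    by move: (expo _ _) => z; case: s; rewrite /sgn; lia.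
have [ii0 |ii0] := eqVneq i i0.
  rewrite ii0 in pw *; rewrite eval_word_cons gen_p expo_letter_genX.
  case: w pw => [|[[j|] t] w] /=; first by rewrite /eval_word big_nil /= addr0.
    rewrite /alpha_next /= eqxx => /andP[/negPf jj0 _]; rewrite jj0 => -> /=.
    by rewrite jj0 addr0.
  by rewrite /alpha_next /= eqxx.
rewrite eval_word_cons gen_tail// word_letter_genM.
case: w pw => [|[[j|] t] w] /=; first by rewrite /eval_word big_nil.
  rewrite /alpha_next /= (negPf ii0) => /andP[yx _].
  have [jj0 |jj0] := eqVneq j i0.
    case: (word _) => [|[k u] z] //= ee.
    (* A nonzero initial exponent means that the reduced word begins with [a] or its inverse, which
       a different basis letter cannot cancel. *)
    have : k = i0.
      by apply/eqP; move: ee; case: eqP => // _; case: (t); rewrite /sgn; lia.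
    by move=> ->; rewrite /inv_letter xpair_eqE /= eq_sym (negPf ii0).
  move=> ->; rewrite /= ifF//; apply: contraNF yx.
  by rewrite /inv_letter xpair_eqE /flip_sign xpair_eqE.
case: (word _) => [|[k u] z] //= _ ee.
have : k = i0.
  apply/eqP; move: ee; case: eqP => // _; case: (t); rewrite /sgn; lia.
by move=> ->; rewrite /inv_letter xpair_eqE /= eq_sym (negPf ii0).
Qed.

(** Unlike [head_spec], this form involves [w] only through its first letter and its value, so that
    two words with the same value can be compared. *)
Let head_kind (w : seq K) : Prop :=
  match ohead w with
  | None => word (ev w) = [::]
  | Some (None, s) =>
      (sgn s * e w = q%:Z - p%:Z /\ b)%R \/ (q%:Z <= sgn s * e w)%R
  | Some (Some i, s) =>
      i = i0 /\ e w = (sgn s * p%:Z)%R \/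
      e w = 0%R /\ ohead (word (ev w)) = Some (i, s)
  end.

Lemma alpha_head_kind w : sorted alpha_next w -> head_kind w.
Proof.
move=> /alpha_head; case: w => [|[[i|] s] w] //=.
  by rewrite /head_kind /= /eval_word big_nil.
rewrite /head_kind /=; case: eqVneq => [-> ->|ii0 ->]; first by left.
by right; rewrite /= (negPf ii0).
Qed.

(** The initial exponent tells the letters apart: [q <> 2p] separates [q - p] from [p] when [b]
    holds, and at exponent 0 the first letter of the reduced word decides. *)
Lemma alpha_ev_head w1 w2 : sorted alpha_next w1 -> sorted alpha_next w2 ->
  ev w1 = ev w2 -> ohead w1 = ohead w2.
Proof.
move=> /alpha_head_kind h1 /alpha_head_kind h2 ew; move: h1 h2.
rewrite /head_kind -ew; case: (ohead w1) => [[[i|] s]|];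
  case: (ohead w2) => [[[j|] t]|] //.
- move=> [[-> h1]|[h1 h1']] [[-> h2]|[h2 h2']].
  + by rewrite h2 in h1; case: s h1; case: t h2 => //; rewrite /sgn; lia.
  + by move: h1; rewrite h2; case: s; rewrite /sgn; lia.
  + by move: h2; rewrite h1; case: t; rewrite /sgn; lia.
  + by move: h1'; rewrite h2' => -[-> ->].
- move: (expo _ _) => z.
  by move=> [[_ ->]|[-> _]]; case: s; case: t; rewrite /sgn; case: (b) q_neq2p; lia.
- by move=> [[_ +]|[_ +]] ew0; rewrite ew0 //= ; case: s; rewrite /sgn; lia.
- move: (expo _ _) => z.
  by move=> h [[_ ze]|[ze _]]; move: h; rewrite {}ze;
    case: s; case: t; rewrite /sgn; case: (b) q_neq2p; lia.
- move: (expo _ _) => z.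
  by case: s; case: t => //; rewrite /sgn; lia.
- by move=> + ew0; rewrite ew0 /=; case: s; rewrite /sgn; lia.
- by move=> ew0 [[_ +]|[_ +]]; rewrite ew0 //= ; case: t; rewrite /sgn; lia.
- by move=> ew0; rewrite ew0 /=; case: t; rewrite /sgn; lia.
Qed.

Lemma alpha_ev_inj : {in [pred w | sorted alpha_next w] &, injective ev}.
Proof.
elim=> [|x w1 IH] [|y w2]; rewrite !inE => s1 s2 ew //.
- by have := alpha_ev_head s1 s2 ew.
- by have := alpha_ev_head s1 s2 ew.
have [xy] := alpha_ev_head s1 s2 ew; rewrite xy in ew *; congr (_ :: _).
apply: IH; rewrite ?inE ?(path_sorted s1) ?(path_sorted s2)//.
by move: ew; rewrite !eval_word_cons => /mulgI.
Qed.

End Injectivity.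

Section Surjectivity.
Hypothesis q_eq : q = ((2 + b) * p)%N.

Let extends x w := exists w',
  [/\ sorted alpha_next w', (size w' <= (size w).+1)%N & gen x * ev w = ev w'].

Let extends_cons x w : path alpha_next x w -> extends x w.
Proof. by move=> pw; exists (x :: w); split=> //; rewrite eval_word_cons. Qed.

Let extends_cancel x w : sorted alpha_next w -> extends x (flip_sign x :: w).
Proof.
move=> pw; exists w; split=> //=; first by rewrite -addn2 leq_addr.
by rewrite eval_word_cons mulgA signed_flip mulgV mul1g.
Qed.

Lemma gen_q_p s : gen (None, s) = gen (Some i0, s) ^+ (2 + b).
Proof. by rewrite gen_q gen_p -expgnA q_eq mulnC. Qed.

Lemma gen_q_mul s : let h := gen (Some i0, s) in
  gen (None, s) = if b then h * h * h else h * h.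
Proof. by rewrite gen_q_p; case: (b); rewrite /= !expgS expg0 mulg1 ?mulgA. Qed.

Let path_p s t w : path alpha_next (Some i0, s) w -> path alpha_next (Some i0, t) w.
Proof. by case: w => [|[[j|] u] w] //=; rewrite /alpha_next /= eqxx. Qed.

Let path_pq s t w : path alpha_next (Some i0, s) w -> path alpha_next (None, t) w.
Proof.
case: w => [|[[j|] u] w] //=; rewrite /alpha_next /= eqxx // => /andP[-> ->] //.
Qed.

(** Up to sign, the rejected continuations of [Q] are [Q^-1], which cancels, and, when [b] fails,
    [P^-1]: there [Q = P^2], so [Q P^-1 = P]. *)
Let extends_q s w : sorted alpha_next w -> extends (None, s) w.
Proof.
case: w => [|y w] pw; first exact: extends_cons.
have [next|] := boolP (alpha_next (None, s) y).
  by apply: extends_cons => /=; rewrite next.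
have [->|ny] := eqVneq y (flip_sign (None, s)).
  by move=> _; apply: extends_cancel; exact: path_sorted pw.
case: y pw ny => [[j|] t] pw; rewrite /alpha_next /flip_sign /= ?xpair_eqE /=.
  rewrite !negb_or negbK => _ /and3P[/eqP jj0 bF /negPf st].
  exists ((Some i0, s) :: w); split=> //.
    by rewrite jj0 in pw; exact: path_p pw.
  have -> : (Some j, t) = flip_sign (Some i0, s) :> K.
    by rewrite /flip_sign jj0 /=; move: st; case: (s); case: (t).
  by rewrite !eval_word_cons signed_flip gen_q_mul (negPf bF) -!mulgA mulVKg.
by case: (s); case: (t).
Qed.

Let extends_p s w : sorted alpha_next w -> extends (Some i0, s) w.
Proof.
elim: w => [|y w IH] pw; first exact: extends_cons.
have [->|ny] := eqVneq y (flip_sign (Some i0, s)).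
  by apply: extends_cancel; exact: path_sorted pw.
case: y pw ny => [[j|] t] pw ny.
  have [jj0|jj0] := eqVneq j i0; last first.
    by apply: extends_cons; rewrite /= {1}/alpha_next /= eqxx jj0.
  have ts : t = s.
    by move: ny; rewrite jj0 /flip_sign xpair_eqE eqxx /=; case: (s); case: (t).
  rewrite jj0 ts in pw *.
  (* [P P] becomes [Q P^-1] when [Q = P^3], and [Q] when [Q = P^2]. *)
  have [bT|bF] := boolP b.
    exists [:: (None, s), (Some i0, ~~ s) & w]; split=> //.
      by rewrite /= {1}/alpha_next /= bT orbT /=; exact: path_p pw.
    rewrite !eval_word_cons -[(Some i0, ~~ s)]/(flip_sign (Some i0, s)) signed_flip.
    by rewrite gen_q_mul bT -!mulgA mulVKg.
  exists ((None, s) :: w); split=> //; first exact: path_pq pw.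
  by rewrite !eval_word_cons gen_q_mul (negPf bF) -mulgA.
(* The next letter is [Q] or its inverse, which commutes with [P]: absorb [P] into the tail [w],
   then put that letter back. Each extension adds at most one letter, and [w] is one letter short of
   the whole word. *)
have [w1 [pw1 sw1 ew1]] := IH (path_sorted pw).
have [w2 [pw2 sw2 ew2]] := extends_q t pw1.
exists w2; split=> //; first exact: leq_trans sw2 _.
rewrite -ew2 -ew1 eval_word_cons !mulgA; congr (_ * _); rewrite gen_q_p.
have [->|ts] := eqVneq t s; first exact/commuteX/commute_refl.
have -> : (Some i0, t) = flip_sign (Some i0, s) :> K.
  by rewrite /flip_sign /=; move: ts; case: (s); case: (t).
by rewrite signed_flip; exact/commuteX/commuteV/commute_refl.
Qed.

Lemma alpha_ev_surj x w : sorted alpha_next w -> exists w',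
  [/\ sorted alpha_next w', (size w' <= (size w).+1)%N & gen x * ev w = ev w'].
Proof.
move=> pw; case: x => -[i|] s; last exact: extends_q.
have [->|ii0] := eqVneq i i0; first exact: extends_p.
case: w pw => [|y w] pw; first exact: extends_cons.
have [->|ny] := eqVneq y (flip_sign (Some i, s)).
  by apply: extends_cancel; exact: path_sorted pw.
apply: extends_cons; apply/andP; split; last exact: pw.
rewrite /alpha_next /= (negPf ii0).
by case: y {pw} ny => -[].
Qed.

End Surjectivity.

Section Eigenvector.
Local Open Scope ring_scope.
Variables (R : realType) (l : R).
Hypothesis d_gt1 : (1 < d)%N.

Definition alpha_weight (x : K) : R :=
  if x.1 is Some i then if i == i0 then (2 * d%:R - 2) * (l - 1) else l * (l - 1)
  else (2 * d%:R - 2) * (l + 1 + b%:R).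

Lemma alpha_weight_gt0 x : 1 < l -> 0 < alpha_weight x.
Proof.
move=> l1; have d2 : 2 <= d%:R :> R by rewrite ler_nat.
have b0 : 0 <= b%:R :> R by [].
by rewrite /alpha_weight; case: x => -[i|] s /=; [case: ifP => _|]; apply: mulr_gt0; lra.
Qed.

(** The weights are chosen so that the rows of [P] and [Q] hold identically; the row of the other
    basis letters is the hypothesis. *)
Lemma alpha_eigen : l ^+ 2 * (l - 1) =
    (2 * d%:R - 2) * 2 * (2 * l + b%:R) + (2 * d%:R - 3) * l * (l - 1) ->
  forall x, \sum_(y | alpha_next x y) alpha_weight y = l * alpha_weight x.
Proof.
move=> lE x.
have card_tail : #|[pred i : 'I_d | i != i0]|%:R = d%:R - 1 :> R.
  by rewrite cardC1 card_ord -subn1 natrB// ltnW.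
rewrite big_mkcond sum_option_bool (bigD1 i0)//=.
case: x => -[i|] s; rewrite /alpha_next /alpha_weight /= eqxx.
- have [_|ii0] := eqVneq i i0.
    rewrite !big_bool /= !add0r.
    rewrite (eq_bigr (fun j => \sum_(t : bool) l * (l - 1))); last by
      move=> j /negPf->.
    by rewrite sum_pairs card_tail; ring.
  rewrite !big_bool /= !xpair_eqE /=.
  have -> : Some i0 == Some i = false by apply/negbTE; rewrite eq_sym; exact: ii0.
  rewrite /= (eq_bigr (fun j => \sum_t (if (Some j, t) != flip_sign (Some i, s)
      then l * (l - 1) else 0))); last by move=> j /negPf->.
  by rewrite sum_pairs_but// card_tail; move: lE; lra.
- rewrite !big_bool /= (eq_bigr (fun j => \sum_(t : bool) l * (l - 1))); last by
  move=> j /negPf->.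
  rewrite sum_pairs card_tail.
  by case: s; case: (b); rewrite /=; ring.
Qed.

End Eigenvector.

Lemma alpha_base_range (S : set (free_group 'I_d)) : 
  S = ([set free_gen i0 ^+ p; free_gen i0 ^+ q] `|`
    [set free_gen i | i in [set i : 'I_d | i != i0]])%classic ->
  S = range alpha_base.
Proof.
move=> ->; apply/seteqP; split=> [x [[->|->]|[i /= /negPf ii0 <-]]|_ [[i|] _ <-]].
- by exists (Some i0); rewrite //= eqxx.
- by exists None.
- by exists (Some i); rewrite //= ii0.
- rewrite /=; case: eqVneq => [_|ii0]; first by left; left.
  by right; exists i.
- by left; right.
Qed.

End Alpha.

(** * The automaton for the generators [a], [b] and [m = ab] *)

Section Beta.
Local Open Scope group_scope.
Variables (d : nat) (i0 i1 : 'I_d).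
Hypothesis i10 : i1 != i0.

Local Notation K := (option 'I_d * bool)%type.

Definition beta_base (o : option 'I_d) : free_group 'I_d :=
  if o is Some i then free_gen i else free_gen i0 * free_gen i1.

Local Notation gen := (signed beta_base).
Local Notation ev := (eval_word gen).

(* With [m = ab], [beta_rot] permutes cyclically [a, b, m^-1] and
   [a^-1, m, b^-1], and the three letters of either cycle multiply to 1.  On the
   other letters it only repeats the condition that [flip_sign] imposes. *)
Definition beta_rot (x : K) : K :=
  if x.1 is Some i then
    if i == i0 then if x.2 then (None, false) else (Some i1, false)
    else if i == i1 then if x.2 then (Some i0, true) else (None, true)
    else flip_sign x
  else if x.2 then (Some i0, false) else (Some i1, true).

Definition beta_next : rel K := fun x y => (y != flip_sign x) && (y != beta_rot x).

Lemma flip_signK : involutive (@flip_sign (option 'I_d)).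
Proof. by case=> i s; rewrite /flip_sign negbK. Qed.

Let i01 : (i0 == i1) = false. Proof. by rewrite eq_sym (negPf i10). Qed.

(** These are the six letters that take part in the relation [m = ab]. *)
Definition triangle (x : K) : bool :=
  if x.1 is Some i then (i == i0) || (i == i1) else true.

Let triangle_ind (P : K -> Prop) :
  (forall s, P (None, s)) -> (forall s, P (Some i0, s)) -> (forall s, P (Some i1, s)) ->
  forall x, triangle x -> P x.
Proof. by move=> P1 P2 P3 [[i|] s] //= /orP[]/eqP->. Qed.

Lemma beta_rotE :
  (forall s, beta_rot (None, s) = if s then (Some i0, false) else (Some i1, true)) *
  (forall s, beta_rot (Some i0, s) = if s then (None, false) else (Some i1, false)) *
  (forall s, beta_rot (Some i1, s) = if s then (Some i0, true) else (None, true)).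
Proof. by rewrite /beta_rot /= !eqxx (negPf i10). Qed.

Let beta_rotN x : ~~ triangle x -> beta_rot x = flip_sign x.
Proof.
by case: x => -[i|] s //=; rewrite negb_or /beta_rot /= => /andP[/negPf-> /negPf->].
Qed.

Lemma beta_rot_mul x : triangle x ->
  gen x * gen (beta_rot x) = gen (flip_sign (beta_rot (beta_rot x))).
Proof.
move: x; apply: triangle_ind => -[]; rewrite !beta_rotE /signed /= ?invgM ?invgK //.
- by rewrite mulgVK.
- by rewrite mulgK.
- by rewrite mulKg.
- by rewrite mulVKg.
Qed.

(** After either letter the forbidden ones are [beta_rot (beta_rot x)] and [flip_sign (beta_rot x)],
    so merging [x] with [beta_rot x] leaves the rest of the word accepted. *)
Lemma beta_next_rot x : triangle x ->
  beta_next (flip_sign (beta_rot (beta_rot x))) =1 beta_next (beta_rot x).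
Proof.
move=> tx y; rewrite /beta_next flip_signK andbC.
by move: x tx; apply: triangle_ind => -[]; rewrite !beta_rotE /flip_sign /= ?beta_rotE.
Qed.

(** A new letter cancels the first letter of [w], merges with it into one letter, or may simply
    precede it. *)
Lemma beta_ev_surj x w : sorted beta_next w -> exists w',
  [/\ sorted beta_next w', (size w' <= (size w).+1)%N & gen x * ev w = ev w'].
Proof.
case: w => [|y w] pw; first by exists [:: x]; rewrite eval_word_cons.
have [->|nf] := eqVneq y (flip_sign x).
  exists w; split; [exact: path_sorted pw|by rewrite /= -addn2 leq_addr|].
  by rewrite eval_word_cons mulgA signed_flip mulgV mul1g.
have [yr|nr] := eqVneq y (beta_rot x).
  (* Outside [triangle] the rotation is the inverse, which is already excluded. *)
  have tx : triangle x by apply: contraNT nf => /beta_rotN<-; exact/eqP.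
  exists (flip_sign (beta_rot (beta_rot x)) :: w); split=> //.
    rewrite yr in pw; case: w pw => [//|z w] /= /andP[yz ->].
    by rewrite beta_next_rot// yz.
  by rewrite !eval_word_cons -beta_rot_mul// -yr mulgA.
exists [:: x, y & w]; rewrite !eval_word_cons; split=> //.
by apply/andP; split; [rewrite /beta_next nf|exact: pw].
Qed.

Definition expand (x : K) : seq (letter 'I_d) :=
  if x.1 is Some i then [:: (i, x.2)]
  else if x.2 then [:: (i1, true); (i0, true)] else [:: (i0, false); (i1, false)].

(** No expansion is empty, so the default letter is never taken. *)
Let fst_letter x := head (i0, true) (expand x).
Let lst_letter x := last (i0, true) (expand x).

(** If the expansions cancelled at the junction, [y] would be the inverse of [x] or would merge with
    it into one letter; [beta_next] forbids both. *)
Let expand_next x y : beta_next x y -> fst_letter y != inv_letter (lst_letter x).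
Proof.
apply: contraTneq; rewrite /beta_next /fst_letter /lst_letter /inv_letter.
case: x => -[i|] s; case: y => -[j|] t /=.
- by move=> [-> ->]; rewrite eqxx.
- by case: t => -[<-]; case: s => //= _; rewrite !beta_rotE /= ?eqxx ?andbF.
- by case: s => -[-> ->]; rewrite !beta_rotE /= ?eqxx ?andbF.
- by case: s; case: t => // _; rewrite eqxx.
Qed.

Let push_cons l (u : seq (letter 'I_d)) :
  ohead u != Some (inv_letter l) -> push l u = l :: u.
Proof. by case: u => [//|k u] /=; rewrite (inj_eq Some_inj) => /negPf->. Qed.

(** Nothing cancels between consecutive letters by [expand_next], nor inside [m], since [i0] and
    [i1] differ. *)
Lemma beta_word_ev w : sorted beta_next w -> word (ev w) = flatten (map expand w).
Proof.
elim: w => [|x w IH] pw; first by rewrite /eval_word big_nil.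
rewrite eval_word_cons map_cons -[flatten _]/(expand x ++ flatten (map expand w)).
rewrite -(IH (path_sorted pw)).
have hd : ohead (word (ev w)) != Some (inv_letter (lst_letter x)).
  rewrite (IH (path_sorted pw)); case: w pw {IH} => [//|y w] /= /andP[/expand_next + _].
  by case: y => -[j|] [].
case: x {pw IH} hd => -[i|] s hd.
  have -> : gen (Some i, s) = letter_gen (i, s) by [].
  by rewrite word_letter_genM (push_cons hd).
case: s hd => hd.
  have -> : gen (None, true) = letter_gen (i1, true) * letter_gen (i0, true).
    by rewrite /signed /= invgM.
  by rewrite -mulgA !word_letter_genM (push_cons hd) push_cons//=
    (inj_eq Some_inj) xpair_eqE i01.
have -> : gen (None, false) = letter_gen (i0, false) * letter_gen (i1, false) by [].
by rewrite -mulgA !word_letter_genM (push_cons hd) push_cons//=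
    (inj_eq Some_inj) xpair_eqE (negPf i10).
Qed.

(* An expanded product letter is never confused with a basis letter because
   [beta_next] forbids spelling it out. *)
Let expand_neq s i t w1 w2 : sorted beta_next ((Some i, t) :: w2) ->
  flatten (map expand ((None, s) :: w1)) <> flatten (map expand ((Some i, t) :: w2)).
Proof.
case: w2 => [|[[j|] u] w2]; first by case: s.
  by case: s => /= /andP[+ _] [ei et ej eu];
    rewrite /beta_next -ei -et -ej -eu beta_rotE eqxx andbF.
by case: s; case: u => // _ /= [_ _ /eqP]; rewrite ?i01 ?(negPf i10).
Qed.

(** Expansions are decoded from the left: two letters of the same kind are compared by their first
    basis letter, and mixed kinds are ruled out by [expand_neq]. *)
Lemma beta_ev_inj : {in [pred w | sorted beta_next w] &, injective ev}.
Proof.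
suff inj w1 w2 : sorted beta_next w1 -> sorted beta_next w2 ->
    flatten (map expand w1) = flatten (map expand w2) -> w1 = w2.
  move=> w1 w2; rewrite !inE => s1 s2 /(congr1 (@word _)).
  by rewrite !beta_word_ev//; exact: inj.
elim: w1 w2 => [|x w1 IH] [|y w2] // s1 s2.
- by case: y s2 => -[j|] [].
- by case: x s1 => -[j|] [].
case: x s1 => -[i|] s s1; case: y s2 => -[j|] t s2.
- by move=> /= [-> -> /(IH _ (path_sorted s1) (path_sorted s2))->].
- by move=> e; have := @expand_neq t i s w2 w1 s1; rewrite e.
- by move=> e; have := @expand_neq s j t w1 w2 s2; rewrite e.
- by case: s s1; case: t s2 => //= s2 s1 [] // /(IH _ (path_sorted s1) (path_sorted s2))->.
Qed.

Section Eigenvector.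
Local Open Scope ring_scope.
Variables (R : realType) (l : R).

Definition beta_weight (x : K) : R := if triangle x then l - 2 * d%:R + 5 else 6.

Lemma beta_weight_gt0 x : 2 * d%:R - 5 < l -> 0 < beta_weight x.
Proof. by rewrite /beta_weight; case: ifP => _; lra. Qed.

Let next_out x y : triangle x -> ~~ triangle y -> beta_next x y.
Proof.
move=> tx ty; have tr : triangle (beta_rot x).
  by move: x tx; apply: triangle_ind => -[]; rewrite beta_rotE /triangle /= ?eqxx ?orbT.
by rewrite /beta_next; apply/andP; split; apply: contraNneq ty => ->.
Qed.

(** A letter of [triangle] is followed by four letters of [triangle] and all [2d - 4] others, which
    gives the quadratic. Another letter is followed by all six and by [2d - 5] others, and this row
    holds identically. *)
Lemma beta_eigen : l ^+ 2 - (2 * d%:R - 1) * l - 4 * d%:R + 4 = 0 ->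
  forall x, \sum_(y | beta_next x y) beta_weight y = l * beta_weight x.
Proof.
move=> lE x; have d2 : (1 < d)%N.
  by move: i10 (ltn_ord i0) (ltn_ord i1); rewrite -val_eqE /=; lia.
pose P := [pred i : 'I_d | (i != i0) && (i != i1)].
have cardP : #|P|%:R = d%:R - 2 :> R.
  have := cardD1 i1 [pred i | i != i0]; rewrite cardC1 card_ord inE i10.
  rewrite (eq_card (B := P)); last by move=> i; rewrite !inE andbC.
  move=> /(congr1 S) /(etrans (esym (ltn_predK d2))) /(congr1 (fun n => n%:R : R)) ->.
  rewrite -[(_ + _).+1]/(#|P|.+2) -addn2 natrD.
  by rewrite addrK.
rewrite big_mkcond sum_option_bool (bigD1 i0)//= (bigD1 i1)//= !big_bool /=.
rewrite /beta_weight /triangle /= !eqxx orbT /= -/(triangle x).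
have wP j : P j -> (j == i0) || (j == i1) = false.
  by move=> /andP[/negPf-> /negPf->].
have [|/[dup] nx /beta_rotN rx] := boolP (triangle x).
  move=> tx; have -> : \sum_(i < d | (i != i0) && (i != i1))
     \sum_s (if beta_next x (Some i, s) then
        if (i == i0) || (i == i1) then l - 2 * d%:R + 5 else 6 else 0) =
     \sum_(i < d | P i) \sum_(s : bool) (6 : R).
    apply: eq_bigr => i Pi; apply: eq_bigr => s _; rewrite wP//.
    by apply/ifT/next_out => //; rewrite /triangle /= wP.
  rewrite sum_pairs cardP; move: x tx; apply: triangle_ind => -[];
    rewrite /beta_next !beta_rotE /flip_sign /= !xpair_eqE /=
      ?(inj_eq Some_inj) ?eqxx ?i01 ?(negPf i10) /=; move: lE; lra.
case: x nx rx => -[i|] s //=; rewrite negb_or.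
move=> /[dup] Pi /andP[/negPf ni0 /negPf ni1] rx.
have nxt y : beta_next (Some i, s) y = (y != flip_sign (Some i, s)).
  by rewrite /beta_next rx andbb.
rewrite !nxt /flip_sign !xpair_eqE /= ?(inj_eq Some_inj).
rewrite ![i0 == _]eq_sym ![i1 == _]eq_sym ni0 ni1 /=.
rewrite (eq_bigr (fun j => \sum_t (if (Some j, t) != flip_sign (Some i, s)
      then 6 else 0))); last first.
  by move=> j Pj; apply: eq_bigr => t _; rewrite nxt wP.
by rewrite (sum_pairs_but (P := P))// cardP; lra.
Qed.

End Eigenvector.

Lemma beta_base_range (S : set (free_group 'I_d)) :
  S = ([set free_gen i0; free_gen i0 * free_gen i1] `|`
    [set free_gen i | i in [set i : 'I_d | i != i0]])%classic ->
  S = range beta_base.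
Proof.
move=> ->; apply/seteqP; split=> [x [[->|->]|[i /= _ <-]]|_ [[i|] _ <-]].
- by exists (Some i0).
- by exists None.
- by exists (Some i).
- have [->|ii0] := eqVneq i i0; first by left; left.
  by right; exists i.
- by left; right.
Qed.

End Beta.

(** * Bounds for [alpha] and the value of [beta] *)

Section GrowthRates.
Variables (R : realType) (d : nat) (d_ge2 : (2 <= d)%N).

Let i0 : 'I_d := Ordinal (ltnW d_ge2).
Let i1 : 'I_d := Ordinal d_ge2.

Let tailE : [set i : 'I_d | (1 <= i)%N]%classic = [set i | i != i0]%classic.
Proof. by apply/funext => i /=; rewrite -val_eqE lt0n. Qed.

Let alpha_range p q : alpha_gens d_ge2 p q = range (alpha_base i0 p q).
Proof. by apply: alpha_base_range; rewrite /alpha_gens /basis_tail tailE. Qed.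

Let beta_range : beta_gens d_ge2 = range (beta_base i0 i1).
Proof. by apply: beta_base_range; rewrite /beta_gens /basis_tail tailE. Qed.

(* This is [l] times the quadratic of [alpha(1,2)] for [b = false], and [l + 1]
   times that of [alpha(1,3)] for [b = true]. *)
Definition alpha_char (b : bool) (l : R) : Prop :=
  l ^+ 2 * (l - 1) =
    (2 * d%:R - 2) * 2 * (2 * l + b%:R) + (2 * d%:R - 3) * l * (l - 1).

Lemma alpha_ge (p q : nat) (b : bool) (l : R) : 1 < l -> alpha_char b l ->
  (0 < p)%N -> (p < q)%N -> (b -> q != (2 * p)%N) -> l <= alpha R d_ge2 p q.
Proof.
move=> l1 lE p0 pq q2p.
have E := alpha_range p q.
apply: (growth_rate_ge_automaton _ l1 (alpha_eigen i0 d_ge2 lE)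
  (finite_range_fin E) (range_signed E) (None, false)).
  by move=> x; exact: alpha_weight_gt0.
exact: alpha_ev_inj.
Qed.

Lemma alpha_le (p q : nat) (b : bool) (l : R) : 1 < l -> alpha_char b l ->
  q = ((2 + b) * p)%N -> alpha R d_ge2 p q <= l.
Proof.
move=> l1 lE qE; have E := alpha_range p q.
apply: (growth_rate_le_automaton _ l1 (alpha_eigen i0 d_ge2 lE)
  (finite_range_fin E) (range_signed E)).
  by move=> x; exact: alpha_weight_gt0.
by move=> x w; exact: alpha_ev_surj.
Qed.

Lemma beta_eq (l : R) : 1 < l -> 2 * d%:R - 5 < l ->
  l ^+ 2 - (2 * d%:R - 1) * l - 4 * d%:R + 4 = 0 -> beta R d_ge2 = l.
Proof.
move=> l1 ld lE; have E := beta_range.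
have i10 : i1 != i0 by [].
have pos x : 0 < beta_weight i0 i1 l x by exact: beta_weight_gt0.
apply/eqP; rewrite eq_le; apply/andP; split.
  apply: (growth_rate_le_automaton pos l1 (beta_eigen i10 lE)
    (finite_range_fin E) (range_signed E)).
  by move=> x w; exact: beta_ev_surj.
apply: (growth_rate_ge_automaton pos l1 (beta_eigen i10 lE)
  (finite_range_fin E) (range_signed E) (None, false)).
exact: beta_ev_inj.
Qed.

End GrowthRates.

(** Writing [f] for the quadratic, [l f(x) - x f(l)] factors as [(x - l) (x l + v)], whose second
    factor is positive. *)
Lemma quadratic_root (R : rcfType) (u v l : R) : 0 < v -> 0 < l ->
  l ^+ 2 - u * l - v = 0 -> forall x, 0 < x /\ x ^+ 2 - u * x - v = 0 <-> x = l.
Proof.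
move=> v0 l0 lE x; split=> [[x0 xE]|->//].
have : (x - l) * (x * l + v) = 0.
  have -> : (x - l) * (x * l + v) =
      l * (x ^+ 2 - u * x - v) - x * (l ^+ 2 - u * l - v) by ring.
  by rewrite xE lE !mulr0 subrr.
move/eqP; rewrite mulf_eq0 subr_eq0 [_ + v == 0]gt_eqF ?addr_gt0 ?mulr_gt0//.
by rewrite orbF => /eqP.
Qed.

Theorem proposition1p7 (R : realType) (d : nat) (d_ge2 : (2 <= d)%N) :
  [/\ (forall x : R,
         0 < x /\ x ^+ 2 - (2 * d%:R - 2) * x - 6 * d%:R + 5 = 0
         <-> x = alpha R d_ge2 1 2)
      /\ alpha R d_ge2 1 2
         = d%:R - 1 + Num.sqrt (d%:R ^+ 2 + 4 * d%:R - 4),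
      (forall x : R,
         0 < x /\ x ^+ 2 - (2 * d%:R - 1) * x - 4 * d%:R + 4 = 0
         <-> x = alpha R d_ge2 1 3)
      /\ alpha R d_ge2 1 3
         = (2 * d%:R - 1 + Num.sqrt (4 * d%:R ^+ 2 + 12 * d%:R - 15)) / 2,
      (forall p q : nat, (1 <= p)%N -> (p < q)%N -> coprime p q ->
         (p, q) <> (1%N, 2%N) ->
         alpha R d_ge2 1 2 < alpha R d_ge2 1 3
         /\ alpha R d_ge2 1 3 <= alpha R d_ge2 p q)
    & beta R d_ge2 = alpha R d_ge2 1 3].
Proof.
have d2 : 2 <= d%:R :> R by rewrite ler_nat.
set l12 := d%:R - 1 + Num.sqrt (d%:R ^+ 2 + 4 * d%:R - 4).
set l13 := (2 * d%:R - 1 + Num.sqrt (4 * d%:R ^+ 2 + 12 * d%:R - 15)) / 2.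
(* This bound and the next give [1 < l12] and [1 < l13], the positivity of the weights in [beta_eq],
   and the strict inequality in (3). *)
have l12_ge : d%:R <= l12.
  rewrite /l12 -addrA lerDl addrC subr_ge0 -[leLHS]sqrtr1 ler_wsqrtr//; nra.
have l13_ge : 2 * d%:R <= l13.
  rewrite /l13 ler_pdivlMr//.
  have : 2 * d%:R + 1 <= Num.sqrt (4 * d%:R ^+ 2 + 12 * d%:R - 15) :> R.
    rewrite -[leLHS]ger0_norm -?sqrtr_sqr; last by lra.
    by rewrite ler_wsqrtr//; lra.
  by lra.
have l12E : l12 ^+ 2 - (2 * d%:R - 2) * l12 - (6 * d%:R - 5) = 0.
  have : 0 <= d%:R ^+ 2 + 4 * d%:R - 4 :> R by nra.
  by move/sqr_sqrtr; rewrite /l12; move: (Num.sqrt _) => s sE; lra.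
have l13E : l13 ^+ 2 - (2 * d%:R - 1) * l13 - (4 * d%:R - 4) = 0.
  have : 0 <= 4 * d%:R ^+ 2 + 12 * d%:R - 15 :> R by nra.
  by move/sqr_sqrtr; rewrite /l13; move: (Num.sqrt _) => s sE; lra.
have l12_gt1 : 1 < l12 by lra.
have l13_gt1 : 1 < l13 by lra.
have c12 : alpha_char d false l12.
  rewrite /alpha_char /=; apply/eqP; rewrite -subr_eq0; apply/eqP.
  by rewrite -[RHS](mulr0 l12) -l12E; ring.
have c13 : alpha_char d true l13.
  rewrite /alpha_char /=; apply/eqP; rewrite -subr_eq0; apply/eqP.
  by rewrite -[RHS](mulr0 (l13 + 1)) -l13E; ring.
have a12 : alpha R d_ge2 1 2 = l12.
  by apply/le_anti/andP; split; [exact: alpha_le c12 _|exact: alpha_ge c12 _ _ _].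
have a13 : alpha R d_ge2 1 3 = l13.
  by apply/le_anti/andP; split; [exact: alpha_le c13 _|exact: alpha_ge c13 _ _ _].
rewrite {}a12 {}a13; split.
- split; last by [].
  move=> x; have -> : x ^+ 2 - (2 * d%:R - 2) * x - 6 * d%:R + 5 =
      x ^+ 2 - (2 * d%:R - 2) * x - (6 * d%:R - 5) by ring.
  have v0 : 0 < 6 * d%:R - 5 :> R by lra.
  exact: (quadratic_root v0 (lt_trans ltr01 l12_gt1) l12E x).
- split; last by [].
  move=> x; have -> : x ^+ 2 - (2 * d%:R - 1) * x - 4 * d%:R + 4 =
      x ^+ 2 - (2 * d%:R - 1) * x - (4 * d%:R - 4) by ring.
  have v0 : 0 < 4 * d%:R - 4 :> R by lra.
  exact: (quadratic_root v0 (lt_trans ltr01 l13_gt1) l13E x).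
- move=> p q p0 pq cop npq; split.
    (* Subtracting the two quadratic equations gives a product with factor [l13 - l12], equal to
       [l13 - 2d + 1], which is at least 1. *)
    rewrite -subr_gt0 -(@pmulr_lgt0 _ (l13 + l12 - (2 * d%:R - 2))); last by lra.
    have -> : (l13 - l12) * (l13 + l12 - (2 * d%:R - 2)) = l13 - 2 * d%:R + 1.
      by move: l12E l13E; lra.
    by lra.
  (* If [q = 2p], coprimality forces [p = 1], which is the excluded pair. *)
  apply: alpha_ge c13 _ _ _ => // _; apply/eqP => qE; apply: npq.
  have p1 : p = 1%N.
    by move: cop; rewrite qE /coprime gcdnMl => /eqP.
  by rewrite qE p1.
- by apply: beta_eq => //; lra.
Qed.
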